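(* Let $(E,\|\cdot\|)$ be a real Banach space and $\mathcal{C}\subset E$ a closed convex cone with $\mathbb{R}_+\mathcal{C}=\mathcal{C}$ and $\mathcal{C}\cap(-\mathcal{C})=\{0\}$. Assume: (H1) there are $\ell\in E'$ with $\|\ell\|=1$ and $K\in[1,\infty)$ with $\langle\ell,\phi\rangle\ge\frac1K\|\phi\|$ for all $\phi\in\mathcal{C}$; (H2) $\rho\in(0,1]$ is fixed such that $\mathcal{C}(\rho)=\{\phi\in\mathcal{C}:B(\phi,\rho\|\phi\|)\subset\mathcal{C}\}$ contains a nonzero element. Set $\mathcal{C}_{\ell=1}(\rho)=\{\phi\in\mathcal{C}(\rho):\langle\ell,\phi\rangle=1\}$. Let $\mathcal{M}\subset L(E)$ be such that, for some $1\le\vartheta<\infty$ and every $L\in\mathcal{M}$: (H3) $L(\mathcal{C}\setminus\{0\})\subset\mathcal{C}(\rho)\setminus\{0\}$, (H4) $\frac1\vartheta\le\|L\|\le\vartheta$. Let $(\Omega,\mathcal{F},\mathbb{P})$ be a probability space with an invertible, measure-preserving, ergodic map $\tau$, let $X=L^\infty(\Omega,E)$ (uniformly bounded Bochner measurable sections, sup norm), and let $(\mathcal{L}_\omega)_{\omega\in\Omega}$ take values in $\mathcal{M}$ such that $\mathbf{L}:X\to X$, $(\mathbf{L}\boldsymbol{\phi})_\omega=\mathcal{L}_{\tau^{-1}\omega}\phi_{\tau^{-1}\omega}$, preserves Bochner measurability of sections, and assume $\int_\Omega|\log\|\mathcal{L}_\omega\||\,d\mathbb{P}(\omega)<+\infty$.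 Let $\mathbf{f}\in X$ be the unique section with $f_\omega\in\mathcal{C}_{\ell=1}(\rho)$ for all $\omega$ satisfying $f_\omega=\mathcal{L}_{\tau^{-1}\omega}f_{\tau^{-1}\omega}/\langle\ell,\mathcal{L}_{\tau^{-1}\omega}f_{\tau^{-1}\omega}\rangle$ for all $\omega$. Set $p_\omega=\langle\ell,\mathcal{L}_{\tau^{-1}\omega}f_{\tau^{-1}\omega}\rangle$. Then: (1) $\omega\mapsto p_\omega\in(0,\infty)$ is measurable and $\log p$ is $\mathbb{P}$-integrable; (2) for $\mathbb{P}$-almost every $\omega$, the characteristic exponent \[\chi_\omega=\limsup_{n\to\infty}\frac1n\log\|\mathcal{L}_{\tau^{-1}\omega}\circ\cdots\circ\mathcal{L}_{\tau^{-n}\omega}\|\] equals $\int_\Omega\log p_\omega\,d\mathbb{P}(\omega)$.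
   Context: A map $\Omega\to E$ is Bochner measurable if it is a uniform limit of $\mathcal{F}$-measurable maps with countable image. *)

(* Defs.v *)
From HB Require Import structures.
From mathcomp Require Import all_boot all_order all_algebra.
From mathcomp Require Import all_classical all_reals all_analysis.
Set Implicit Arguments. Unset Strict Implicit. Unset Printing Implicit Defensive.
Import Order.TTheory GRing.Theory Num.Theory.
Import numFieldNormedType.Exports.
Local Open Scope classical_set_scope.
Local Open Scope ring_scope.

Definition opnorm (R : realType) (V W : normedModType R) (f : V -> W) : R :=
  sup [set `|f x| | x in [set x : V | `|x| <= 1]].

Definition is_linear (R : realType) (V W : normedModType R) (f : V -> W) :=
  forall (a : R) (x y : V), f (a *: x + y) = a *: f x + f y.

Definition bounded_linear (R : realType) (V W : normedModType R) (f : V -> W) :=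
  is_linear f /\ continuous f.

Definition proper_closed_convex_cone (R : realType) (E : normedModType R)
    (C : set E) :=
  [/\ closed C,
      (forall x y (t : R), C x -> C y -> 0 <= t -> t <= 1 ->
         C (t *: x + (1 - t) *: y)),
      [set t *: x | t in [set t : R | 0 <= t] & x in C] = C &
      C `&` [set - x | x in C] = [set 0]].

Definition cone_rho (R : realType) (E : normedModType R) (C : set E) (rho : R)
  : set E := [set phi | C phi /\ ball phi (rho * `|phi|) `<=` C].

Definition cone_rho_l1 (R : realType) (E : normedModType R) (C : set E)
    (rho : R) (l : E -> R) : set E :=
  [set phi | cone_rho C rho phi /\ l phi = 1].

Definition countably_valued_measurable d (T : measurableType d)
    (R : realType) (E : normedModType R) (g : T -> E) :=
  countable (range g) /\ (forall y : E, measurable (g @^-1` [set y])).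

Definition bochner_measurable d (T : measurableType d)
    (R : realType) (E : normedModType R) (f : T -> E) :=
  exists g : nat -> T -> E,
    (forall n, countably_valued_measurable (g n)) /\
    forall e : R, 0 < e -> exists N : nat, forall n, (N <= n)%N ->
      forall w, `|g n w - f w| <= e.

Definition Linfty_section d (T : measurableType d)
    (R : realType) (E : normedModType R) (f : T -> E) :=
  bochner_measurable f /\ exists M : R, forall w, `|f w| <= M.

Definition invertible_mp_ergodic d (T : measurableType d) (R : realType)
    (P : probability T R) (tau tinv : T -> T) :=
  [/\ cancel tau tinv /\ cancel tinv tau,
      measurable_fun setT tau, measurable_fun setT tinv,
      (forall A, measurable A -> P (tau @^-1` A) = P A) &
      (forall A, measurable A -> tau @^-1` A = A ->
         P A = 0%E \/ P A = 1%E)].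

(* L^{(n)}_{tau^{-n} w} = L_{tau^{-1} w} o ... o L_{tau^{-n} w} *)
Fixpoint cocycle (T : Type) (E : Type) (L : T -> E -> E) (tinv : T -> T)
    (n : nat) (w : T) : E -> E :=
  match n with
  | 0 => id
  | n'.+1 => cocycle L tinv n' w \o L (iter n'.+1 tinv w)
  end.

(* Main.v *)
(** Let [p w] be the factor in [L (tinv w) (f (tinv w)) = p w *: f w] and let
    [Q n] be the product of [p (tinv^k w)] over [k < n].  Equivariance gives
    [l (cocycle n w (f (tinv^n w))) = Q n].  As [f] lies [rho]-deep inside the
    cone and [l] controls the norm on the cone, the operator norm of the cocycle
    and [Q n] agree up to a multiplicative constant [D] independent of [n] and
    [w].  The case [n = 1] bounds [ln p], and the general case shows that the
    characteristic exponent is the limit of the Birkhoff averages of [ln p]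
    along [tinv].  For bounded functions the ergodic theorem follows from
    Garsia's maximal inequality: if the integral of [h] is negative, the
    invariant set where the Birkhoff sums of [h] are unbounded above cannot have
    measure one, hence it is null. *)
Require Import Defs.
From HB Require Import structures.
From mathcomp Require Import all_boot all_order all_algebra.
From mathcomp Require Import all_classical all_reals all_analysis.
From mathcomp Require Import measurable_realfun lra.
Set Implicit Arguments. Unset Strict Implicit.
Unset Printing Implicit Defensive.
Import Order.TTheory GRing.Theory Num.Theory.
Import numFieldNormedType.Exports.
Local Open Scope classical_set_scope.
Local Open Scope ring_scope.

(** * Birkhoff's ergodic theorem for bounded functions *)

Section Birkhoff.
Context {d : measure_display} {T : measurableType d} {R : realType}.
Variables (P : probability T R) (phi : T -> T).
Hypothesis mphi : measurable_fun setT phi.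
Hypothesis phiP : forall A, measurable A -> P (phi @^-1` A) = P A.

Lemma bounded_integrable (h : T -> R) (B : R) : measurable_fun setT h ->
  (forall x, `|h x| <= B) -> P.-integrable setT (EFin \o h).
Proof.
move=> mh hB; apply: measurable_bounded_integrable => //.
  by apply: le_lt_trans (probability_le1 _ _) (ltry _).
exists B; split; first exact: num_real.
by move=> M BM x _; exact: le_trans (hB x) (ltW BM).
Qed.

Lemma Rintegral_preserving (h : T -> R) : measurable_fun setT h ->
  (forall x, 0 <= h x) -> \int[P]_x h (phi x) = \int[P]_x h x.
Proof.
move=> mh h0; congr fine.
rewrite -(@eq_measure_integral _ _ _ _ P (pushforward P phi) (EFin \o h)).
  rewrite ge0_integral_pushforward//; first exact/measurable_EFinP.
  by move=> y _ /=; rewrite lee_fin.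
by move=> A mA _; exact: phiP.
Qed.

Definition birkhoff_sum (h : T -> R) n x := \sum_(k < n) h (iter k phi x).

Lemma birkhoff_sumS h n x :
  birkhoff_sum h n.+1 x = h x + birkhoff_sum h n (phi x).
Proof.
rewrite /birkhoff_sum big_ord_recl/=; congr (_ + _).
by apply: eq_bigr => k _; rewrite -iterS iterSr.
Qed.

Lemma measurable_iter n : measurable_fun setT (iter n phi).
Proof.
by elim: n => [|n ih]; [exact: measurable_id|exact: measurableT_comp].
Qed.

Lemma measurable_birkhoff_sum h n :
  measurable_fun setT h -> measurable_fun setT (birkhoff_sum h n).
Proof.
move=> mh; apply: measurable_sum => k.
exact: measurableT_comp (measurable_iter k).
Qed.

(* [max_sum h n x] is the maximum of the first [n + 1] Birkhoff sums. *)
Fixpoint max_sum (h : T -> R) n x : R :=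
  if n is m.+1 then Num.max 0 (h x + max_sum h m (phi x)) else 0.

Lemma max_sum_ge0 h n x : 0 <= max_sum h n x.
Proof. by case: n => [|n]//=; rewrite le_max lexx. Qed.

Lemma birkhoff_sum_le_max h n x : birkhoff_sum h n x <= max_sum h n x.
Proof.
elim: n x => [|n ih] x; first by rewrite /birkhoff_sum big_ord0.
by rewrite birkhoff_sumS /= le_max lerD2l ih orbT.
Qed.

Lemma max_sum_homo h x : {homo max_sum h ^~ x : m n / (m <= n)%N >-> m <= n}.
Proof.
apply: homo_leq => //; first exact: le_trans.
move=> n; elim: n x => [|n ih] x; first exact: max_sum_ge0.
by rewrite /= ge_max !le_max lexx/= lerD2l ih orbT.
Qed.

Lemma measurable_max_sum h n :
  measurable_fun setT h -> measurable_fun setT (max_sum h n).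
Proof.
move=> mh; elim: n => [|n ih]; first exact: measurable_cst.
apply: measurable_maxr => //; apply: measurable_funD => //.
exact: measurableT_comp.
Qed.

Lemma max_sum_bound h B n x : (forall x, `|h x| <= B) ->
  `|max_sum h n x| <= B *+ n.
Proof.
move=> hB; have B0 : 0 <= B := le_trans (normr_ge0 _) (hB x).
rewrite ger0_norm ?max_sum_ge0//.
elim: n x => [|n ih] x; first by rewrite mulr0n.
rewrite /= ge_max mulrn_wge0//= mulrS lerD//.
exact: le_trans (ler_norm _) (hB x).
Qed.

(* Garsia's argument: [h = max_sum h n.+1 - max_sum h n \o phi] wherever
   [max_sum h n.+1 > 0], and the right-hand side has nonnegative integral. *)
Lemma maximal_ergodic (h : T -> R) (B : R) n : measurable_fun setT h ->
  (forall x, `|h x| <= B) ->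
  - B * fine (P [set x | max_sum h n.+1 x <= 0]) <= \int[P]_x h x.
Proof.
move=> mh hB; set Z := [set x | _].
have mM k := @measurable_max_sum h k mh.
have mZ : measurable Z.
  by rewrite -[Z]setTI; exact: measurable_fun_le.
have iM k : P.-integrable setT (EFin \o max_sum h k).
  by apply: (@bounded_integrable _ (B *+ k)) => // x; exact: max_sum_bound.
have mMphi k : measurable_fun setT (fun x => max_sum h k (phi x)).
  exact: measurableT_comp.
have iMphi k : P.-integrable setT (EFin \o (fun x => max_sum h k (phi x))).
  by apply: (@bounded_integrable _ (B *+ k)) => // x; exact: max_sum_bound.
have mZi : measurable_fun setT (\1_Z : T -> R) by exact: measurable_indic.
have iZ : P.-integrable setT (EFin \o (\1_Z : T -> R)).
  apply: (@bounded_integrable _ 1) => // x.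
  by rewrite indicE; case: (x \in Z); rewrite ?normr1 ?normr0.
have iD : P.-integrable setT
    (EFin \o (fun x => max_sum h n.+1 x - max_sum h n (phi x))).
  exact: integrableB (iM _) (iMphi _).
have iBZ : P.-integrable setT (EFin \o (fun x => - B * \1_Z x)).
  exact: (integrableZl measurableT (- B) iZ).
have -> : - B * fine (P Z) = \int[P]_x (- B * \1_Z x).
  rewrite RintegralZl//; congr (_ * _).
  by rewrite /Rintegral integral_indic// setIT.
(* On [Z] the first maximum vanishes and the second is nonnegative, so the term [- B] brings the
   integrand below [h]; off [Z] the integrand equals [h]. *)
apply: (@le_trans _ _
  (\int[P]_x (max_sum h n.+1 x - max_sum h n (phi x) + - B * \1_Z x))).
  rewrite RintegralD// RintegralB// Rintegral_preserving//; last first.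
    by move=> x; exact: max_sum_ge0.
  rewrite lerDr subr_ge0; apply: le_Rintegral => // x _.
  exact: max_sum_homo.
apply: le_Rintegral => //.
- exact: (integrableD measurableT iD iBZ).
- exact: bounded_integrable hB.
move=> x _; have := max_sum_ge0 h n (phi x).
have := hB x; rewrite ler_norml => /andP[hB1 hB2].
rewrite indicE; have [|] := boolP (x \in Z).
  rewrite inE /Z/= => + ?; rewrite ge_max => /andP[_ hx].
  rewrite mulr1 (max_idPl _)//; lra.
rewrite notin_setE /Z/= => /negP; rewrite -ltNge lt_max ltxx/= => hx M0.
rewrite mulr0 addr0 (max_idPr (ltW hx)); lra.
Qed.

Hypothesis phi_ergodic : forall A, measurable A -> phi @^-1` A = A ->
  P A = 0%E \/ P A = 1%E.

Lemma birkhoff_sum_bounded_above (h : T -> R) (B : R) : measurable_fun setT h ->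
  (forall x, `|h x| <= B) -> \int[P]_x h x < 0 ->
  {ae P, forall x, exists k : nat, forall n, birkhoff_sum h n x <= k%:R}.
Proof.
move=> mh hB h0.
pose A := \bigcap_k \bigcup_n [set x | k%:R <= birkhoff_sum h n x].
have mA : measurable A.
  apply: bigcapT_measurable => k; apply: bigcupT_measurable => n.
  rewrite -[X in measurable X]setTI.
  by apply: measurable_fun_le => //; exact: measurable_birkhoff_sum.
(* Sums along [x] and [phi x] differ by the bounded term [h x], so only the threshold shifts, by at
   most [m]. *)
have Binv : phi @^-1` A = A.
  have [m Bm] : exists m : nat, B <= m%:R.
    by exists (Num.truncn B).+1; rewrite ltW// truncnS_gt.
  have hm x : - m%:R <= h x <= m%:R by rewrite -ler_norml (le_trans (hB x)).
  apply/seteqP; split => x Ax k _.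
  - have [n _ /= kn] := Ax (k + m)%N I; exists n.+1 => //=.
    rewrite birkhoff_sumS; have := hm x; rewrite natrD in kn.
    by move=> /andP[? ?]; lra.
  (* The threshold is made positive to exclude the empty sum, from which no first term can be
     removed. *)
  - have [[|n] _ /= kn] := Ax (k + m).+1 I.
      by move: kn; rewrite /birkhoff_sum big_ord0 leNgt ltr0Sn.
    exists n => //=; rewrite birkhoff_sumS -natr1 natrD in kn; have := hm x.
    by move=> /andP[? ?]; lra.
have [PA|PA] := phi_ergodic mA Binv.
  exists A; split => // x /= /forallNP Ax k _.
  apply: contrapT => nk; apply: (Ax k) => n.
  by rewrite leNgt; apply/negP => /ltW kn; apply: nk; exists n.
(* Suppose [P A = 1]. On [A] some Birkhoff sum is at least 1, so the decreasing sets [F n] have a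
   null intersection and [P (F n)] tends to 0. *)
exfalso; pose F n := [set x | max_sum h n x <= 0].
have mF n : measurable (F n).
  rewrite -[F n]setTI; apply: measurable_fun_le => //.
  exact: measurable_max_sum.
have mF' : measurable (\bigcap_n F n) by exact: bigcapT_measurable.
have PF : P (\bigcap_n F n) = 0%E.
  apply/eqP; rewrite eq_le measure_ge0 andbT.
  have <- : P (~` A) = 0%E by rewrite probability_setC// PA subee.
  apply: le_measure; rewrite ?inE//; first exact: measurableC.
  move=> x Fx Ax; have [n _ /=] := Ax 1%N I.
  rewrite leNgt (le_lt_trans (birkhoff_sum_le_max _ _ _))//.
  exact: le_lt_trans (Fx n I) ltr01.
have : (P \o F) n @[n --> \oo] --> P (\bigcap_n F n).
  apply: nonincreasing_cvg_mu => //.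
    by rewrite (le_lt_trans (probability_le1 _ _))// ltry.
  move=> m n mn; apply/subsetPset => x /=; apply: le_trans.
  exact: max_sum_homo.
rewrite PF => /fine_cvgP[_].
(* Once [P (F N.+1)] is below this number, [- B * P (F N.+1)] exceeds the integral of [h], against
   [maximal_ergodic]. *)
have e0 : 0 < - (\int[P]_x h x) / (`|B| + 1).
  by rewrite divr_gt0 ?oppr_gt0// ltr_wpDl.
move=> /cvgrPdist_lt/(_ _ e0)[N _ /(_ N.+1 (leqnSn N))/=].
rewrite sub0r normrN ger0_norm ?fine_ge0// ltr_pdivlMr ?ltr_wpDl// => hN.
have := maximal_ergodic N mh hB.
have : 0 <= fine (P (F N.+1)) by rewrite fine_ge0.
move: hN; rewrite -/(F N.+1); move: (fine _) => q; have := ler_norm B.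
move: (\int[P]_x _) => I; nra.
Qed.

(** Subtracting the integral plus [e] from [h] leaves a function of integral [- e], whose Birkhoff
    sums are almost surely bounded above. *)
Lemma birkhoff_sum_bound (h : T -> R) (B : R) : measurable_fun setT h ->
  (forall x, `|h x| <= B) -> forall e, 0 < e ->
  {ae P, forall x, exists k : nat, forall n,
    birkhoff_sum h n x <= (\int[P]_x h x + e) * n%:R + k%:R}.
Proof.
move=> mh hB e e0; set c := _ + e.
have ih := bounded_integrable mh hB.
have ic : P.-integrable setT (EFin \o (fun=> c)).
  by apply: (@bounded_integrable _ `|c|).
pose g x := h x - c.
have mg : measurable_fun setT g by exact: measurable_funB.
have gB x : `|g x| <= B + `|c| by rewrite (le_trans (ler_normB _ _))// lerD2r.
have g0 : \int[P]_x g x < 0.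
  rewrite RintegralB// Rintegral_cst// [X in fine X](probability_setT P).
  by rewrite /c /=; lra.
have := birkhoff_sum_bounded_above mg gB g0.
apply: filterS => x [k hk]; exists k => n.
have := hk n; rewrite /birkhoff_sum /g sumrB sumr_const card_ord -mulr_natr.
lra.
Qed.

(** The upper bounds for [h] and [- h] give both sides. Taking [e] among the numbers [j.+1%:R^-1]
    leaves countably many null sets, hence one exceptional set for all [e]. *)
Theorem birkhoff_bounded (h : T -> R) (B : R) : measurable_fun setT h ->
  (forall x, `|h x| <= B) ->
  {ae P, forall x, forall e, 0 < e -> exists k : nat, forall n,
    `|birkhoff_sum h n x - (\int[P]_x h x) * n%:R| <= e * n%:R + k%:R}.
Proof.
move=> mh hB; have ih := bounded_integrable mh hB.
have mhN : measurable_fun setT (fun x => - 1 * h x) by exact: measurable_funM.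
have hNB x : `|- 1 * h x| <= B by rewrite mulN1r normrN.
have j0 j : 0 < j.+1%:R^-1 :> R by rewrite invr_gt0.
have H1 := ae_foralln (fun j => birkhoff_sum_bound mh hB (j0 j)).
have H2 := ae_foralln (fun j => birkhoff_sum_bound mhN hNB (j0 j)).
apply: filterS2 H1 H2 => x h1 h2 e e0.
have [j je] : exists j : nat, j.+1%:R^-1 <= e.
  exists (Num.truncn e^-1); rewrite -[leRHS]invrK lef_pV2 ?posrE ?invr_gt0//.
  by rewrite ltW// truncnS_gt.
have [k1 hk1] := h1 j; have [k2 hk2] := h2 j.
exists (k1 + k2)%N => n; rewrite ler_norml natrD.
have := hk1 n; have := hk2 n.
rewrite RintegralZl// /birkhoff_sum -mulr_sumr.
have n0 : 0 <= n%:R :> R by [].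
have := ler_wpM2r n0 je.
have : 0 <= k1%:R :> R by []. have : 0 <= k2%:R :> R by [].
move: (\sum_(k < n) _) (\int[P]_x _) => S I.
move: (j.+1%:R^-1) (n%:R) (k1%:R) (k2%:R) => q m a b *.
apply/andP; split; nra.
Qed.

End Birkhoff.

(** * Operator norms and their control on the cone *)

Section OperatorNorm.
Context {R : realType} {V W : normedModType R}.
Implicit Types A : V -> W.

Lemma is_linear0 A : is_linear A -> A 0 = 0.
Proof. by move=> /(_ (-1) 0 0); rewrite !scaleN1r !addNr. Qed.

Lemma is_linearZ A : is_linear A -> forall a x, A (a *: x) = a *: A x.
Proof.
by move=> lA a x; have := lA a x 0; rewrite (is_linear0 lA) !addr0.
Qed.

Lemma le_opnorm A M x : is_linear A ->
  (forall y, `|y| <= 1 -> `|A y| <= M) -> `|A x| <= opnorm A * `|x|.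
Proof.
move=> lA AM; have [->|x0] := eqVneq x 0.
  by rewrite (is_linear0 lA) !normr0 mulr0.
have nx : 0 < `|x| by rewrite normr_gt0.
rewrite -ler_pdivrMr//; apply: ub_le_sup.
  by exists M => _ [y /= y1 <-]; exact: AM.
exists (`|x|^-1 *: x) => /=.
  by rewrite normrZ normfV normr_id mulVf ?gt_eqF.
by rewrite is_linearZ// normrZ normfV normr_id mulrC.
Qed.

(** The supremum of an unbounded set is 0 by convention, so a positive [opnorm A] forces [A] to be
    bounded on the unit ball. *)
Lemma opnorm_gt0_le A x : is_linear A -> 0 < opnorm A ->
  `|A x| <= opnorm A * `|x|.
Proof.
move=> lA A0; have [[_ [M AM]]|nA] :=
    pselect (has_sup [set `|A y| | y in [set y : V | `|y| <= 1]]).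
  by apply: (@le_opnorm _ M) => // y y1; apply: AM; exists y.
by move: A0; rewrite /opnorm sup_out// ltxx.
Qed.

Lemma opnorm_le A M : (forall x, `|x| <= 1 -> `|A x| <= M) -> opnorm A <= M.
Proof.
move=> AM; apply: ge_sup; first by exists `|A 0|, 0 => //=; rewrite normr0.
by move=> _ [x /= x1 <-]; exact: AM.
Qed.

End OperatorNorm.

(* Since [f] is [rho]-deep in the cone, [f + (rho/2) x] and [f - (rho/2) x]
   both lie in it when [`|x| <= 1]; [A] keeps them there, and (H1) bounds the
   norm of their difference by the sum of their images under [l]. *)
Lemma cone_preserving_le (R : realType) (E : normedModType R) (C : set E)
    (l : E -> R) (K rho : R) (A : E -> E) (f x : E) :
  is_linear l -> 0 < K -> (forall y, C y -> K^-1 * `|y| <= l y) ->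
  0 < rho -> is_linear A -> (forall y, C y -> C (A y)) ->
  cone_rho C rho f -> 1 <= `|f| -> `|x| <= 1 ->
  `|A x| <= 2 * K / rho * l (A f).
Proof.
move=> ll K0 H1 rho0 lA AC [_ fC] f1 x1.
(* The ball in [cone_rho] is open; half the radius keeps the point strictly inside. *)
have Cf s : `|s| <= rho / 2 -> C (s *: x + f).
  move=> hs; apply: fC; rewrite -ball_normE /ball_/=.
  rewrite opprD addrCA subrr addr0 normrN normrZ.
  have : `|s| * `|x| <= rho / 2 * 1 by rewrite ler_pM.
  have : rho * 1 <= rho * `|f| by rewrite ler_pM2l.
  lra.
have hs : `|rho / 2| <= rho / 2 by rewrite ger0_norm// divr_ge0// ltW.
have hNs : `|- (rho / 2)| <= rho / 2 by rewrite normrN.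
have := H1 _ (AC _ (Cf _ hNs)); have := H1 _ (AC _ (Cf _ hs)).
rewrite !lA !ll.
set u := A x; set v := A f.
(* When (H1) is applied to both norms, the multiples of [l u] cancel and [2 * K * l v] remains. *)
have : rho * `|u| <= `|rho / 2 *: u + v| + `|- (rho / 2) *: u + v|.
  have -> : rho * `|u| = `|(rho / 2 *: u + v) - (- (rho / 2) *: u + v)|.
    rewrite opprD addrACA subrr addr0 -scaleNr opprK -scalerDl.
    by rewrite -splitr normrZ gtr0_norm.
  exact: ler_normB.
rewrite ![_ *: l u]/GRing.scale/=.
rewrite ![K^-1 * _]mulrC !ler_pdivrMr// => h1 h2 h3.
rewrite mulrAC ler_pdivlMr// mulrC -mulrA; lra.
Qed.

(** * Scalar measurability of Bochner measurable sections *)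

Section CountablyValued.
Context {d : measure_display} {T : measurableType d} {R : realType}.
Context {E : normedModType R}.

Lemma measurable_countably_valued (g : T -> E) (l : E -> R) :
  countably_valued_measurable g -> measurable_fun setT (l \o g).
Proof.
move=> [cg mg] _ Y mY; rewrite setTI.
have /countable_injP[i ii] := cg.
(* As [i] is injective on the range of [g], each [F k] is empty or a single fibre of [g]. *)
pose F k := [set x | Y (l (g x)) /\ i (g x) = k].
have -> : (l \o g) @^-1` Y = \bigcup_k F k.
  by apply/seteqP; split => [x Yx|x [k _ []]//]; exists (i (g x)).
apply: bigcupT_measurable => k.
have [[x [Yx ix]]|F0] := pselect (F k !=set0).
  have -> : F k = g @^-1` [set g x].
    apply/seteqP; split => [z [_ iz]|z /= zx]; last by rewrite /F/= zx.
    by apply: ii; rewrite ?inE ?iz.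
  exact: mg.
by have -> : F k = set0 by apply/seteqP; split => // x Fx; apply: F0; exists x.
Qed.

(** A linear [l] bounded by the norm is 1-Lipschitz, so [l \o g] is a pointwise limit of the
    measurable [l \o gn n]. *)
Lemma measurable_bochner (g : T -> E) (l : E -> R) : is_linear l ->
  (forall x, `|l x| <= `|x|) -> bochner_measurable g ->
  measurable_fun setT (l \o g).
Proof.
move=> ll l1 [gn [mgn hgn]].
apply: (@measurable_fun_cvg _ _ _ _ (fun n => l \o gn n)).
  by move=> n; exact: measurable_countably_valued.
move=> x _; apply/cvgrPdist_le => e e0.
have [N hN] := hgn e e0; exists N => // n /= Nn.
rewrite distrC -[l (g x)]mul1r -mulNr addrC.
rewrite -[_ * l (g x)]/(-1 *: l (g x)) -ll scaleN1r addrC.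
exact: le_trans (l1 _) (hN n Nn x).
Qed.

End CountablyValued.

(** * Cocycle products along the backward orbit *)

Section Cocycle.
Context {R : realType} {E : normedModType R} {T : Type}.
Variables (L : T -> E -> E) (tinv : T -> T).

Lemma cocycle_linear n w : (forall w, is_linear (L w)) ->
  is_linear (cocycle L tinv n w).
Proof.
by move=> lL; elim: n => [//|n ih] a x y /=; rewrite lL ih.
Qed.

Lemma cocycle_stable (C : set E) n w :
  (forall w x, C x -> C (L w x)) -> forall x, C x -> C (cocycle L tinv n w x).
Proof. by move=> LC; elim: n => [//|n ih] x Cx /=; exact/ih/LC. Qed.

(** The innermost factor of the product of length [n.+1] carries [f (iter n.+1 tinv w)] to
    [p (iter n tinv w) *: f (iter n tinv w)], which adds the last factor of the scalar product. *)
Lemma cocycle_equivariant (f : T -> E) (p : T -> R) n w :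
  (forall w, is_linear (L w)) ->
  (forall w, L (tinv w) (f (tinv w)) = p w *: f w) ->
  cocycle L tinv n w (f (iter n tinv w)) =
    (\prod_(k < n) p (iter k tinv w)) *: f w.
Proof.
move=> lL fE; elim: n => [|n ih]; first by rewrite big_ord0 scale1r.
rewrite /= fE (is_linearZ (cocycle_linear n w lL)) ih.
by rewrite big_ord_recr/= scalerA mulrC.
Qed.

End Cocycle.

(** * Logarithmic estimates and averages with sublinear error *)

Lemma ln_prod (R : realType) (p : nat -> R) n : (forall k, 0 < p k) ->
  ln (\prod_(k < n) p k) = \sum_(k < n) ln (p k).
Proof.
move=> p0; elim: n => [|n ih]; first by rewrite !big_ord0 ln1.
by rewrite !big_ord_recr/= lnM ?ih// posrE// prodr_gt0.
Qed.

Lemma ln_dist_le (R : realType) (a b D : R) : 0 < a -> 0 < b -> 0 < D ->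
  a <= D * b -> b <= D * a -> `|ln a - ln b| <= ln D.
Proof.
move=> a0 b0 D0 ab ba; rewrite ler_norml.
have : ln a <= ln (D * b) by rewrite ler_ln ?posrE// mulr_gt0.
have : ln b <= ln (D * a) by rewrite ler_ln ?posrE// mulr_gt0.
rewrite !lnM ?posrE//; lra.
Qed.

Lemma cvg_of_sublinear_error (R : realType) (u : nat -> R) (I : R) :
  (forall e, 0 < e -> exists k : R, forall n,
    `|u n - I * n%:R| <= e * n%:R + k) ->
  n%:R^-1 * u n @[n --> \oo] --> I.
Proof.
move=> uI; apply/cvgrPdist_le => e e0.
have [k hk] := uI _ (divr_gt0 e0 (ltr0Sn R 1)).
(* Beyond this index [k] is at most [e / 2 * n%:R], the other half of the error. *)
exists (Num.truncn (k / (e / 2))).+1 => // n /= Nn.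
have n0 : 0 < n%:R :> R by rewrite ltr0n (leq_ltn_trans _ Nn).
have kn : k <= e / 2 * n%:R.
  rewrite mulrC -ler_pdivrMr ?divr_gt0// ltW// (lt_le_trans (truncnS_gt _))//.
  by rewrite ler_nat.
have -> : I - n%:R^-1 * u n = (I * n%:R - u n) / n%:R.
  by rewrite mulrBl mulfK ?gt_eqF// [u n / _]mulrC.
rewrite normrM normfV (gtr0_norm n0) ler_pdivrMr// distrC.
rewrite (le_trans (hk n))//; lra.
Qed.

(** * The characteristic exponent *)

Theorem theorem2p2 (R : realType) (E : completeNormedModType R)
  (C : set E) (l : E -> R) (K rho theta : R)
  (d : measure_display) (Omega : measurableType d) (P : probability Omega R)
  (tau tinv : Omega -> Omega) (L : Omega -> E -> E) (f : Omega -> E) :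
  (* the cone *)
  proper_closed_convex_cone C ->
  (* (H1) *)
  bounded_linear l -> opnorm l = 1 -> 1 <= K ->
  (forall phi, C phi -> K^-1 * `|phi| <= l phi) ->
  (* (H2) *)
  0 < rho -> rho <= 1 -> (exists phi, phi != 0 /\ cone_rho C rho phi) ->
  (* the family L_w takes values in M *)
  1 <= theta ->
  (forall w, bounded_linear (L w)) ->
  (* (H3) *)
  (forall w phi, C phi -> phi != 0 ->
     cone_rho C rho (L w phi) /\ L w phi != 0) ->
  (* (H4) *)
  (forall w, theta^-1 <= opnorm (L w) /\ opnorm (L w) <= theta) ->
  (* invertible, measure preserving, ergodic tau with inverse tinv *)
  invertible_mp_ergodic P tau tinv ->
  (* the transfer operator preserves Bochner measurability of sections *)
  (forall phi : Omega -> E, Linfty_section phi ->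
     bochner_measurable (fun w => L (tinv w) (phi (tinv w)))) ->
  (* log-integrability *)
  P.-integrable setT (fun w => (`| ln (opnorm (L w)) |)%:E) ->
  (* the equivariant section f *)
  Linfty_section f ->
  (forall w, cone_rho_l1 C rho l (f w)) ->
  (forall w, f w = (l (L (tinv w) (f (tinv w))))^-1 *: L (tinv w) (f (tinv w))) ->
  let p := fun w => l (L (tinv w) (f (tinv w))) in
  [/\ (forall w, 0 < p w),
      measurable_fun setT p,
      P.-integrable setT (fun w => (ln (p w))%:E) &
      {ae P, forall w,
         limn_esup (fun n : nat =>
           ((n%:R)^-1 * ln (opnorm (cocycle L tinv n w)))%:E)
         = (\int[P]_x (ln (p x))%:E)%E}].
Proof.
move=> [_ _ _ Cpt] [ll _] l1 K1 H1 rho0 rho1 _ th1 bL H3 H4.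
move=> [[tauK tinvK] mtau mtinv tauP tau_erg] Lmeas _ fX fC fE p.
have lL w : is_linear (L w) by case: (bL w).
have K0 : 0 < K := lt_le_trans ltr01 K1.
have th0 : 0 < theta := lt_le_trans ltr01 th1.
have lnorm x : `|l x| <= `|x|.
  by have := opnorm_gt0_le x ll; rewrite l1 mul1r; exact.
have C0 : C 0 by have [//] : (C `&` [set - x | x in C]) 0 by rewrite Cpt.
have LC w x : C x -> C (L w x).
  move=> Cx; have [->|x0] := eqVneq x 0; first by rewrite (is_linear0 (lL w)).
  by have [[]] := H3 w x Cx x0.
have f1 w : 1 <= `|f w|.
  by have [_ lf] := fC w; rewrite -lf (le_trans (ler_norm _)).
have fK w : `|f w| <= K.
  have [[Cf _] lf] := fC w; have := H1 _ Cf.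
  by rewrite lf mulrC ler_pdivrMr// mul1r.
have f0 w : f w != 0 by rewrite -normr_gt0 (lt_le_trans ltr01).
have p0 w : 0 < p w.
  have [[Cf _] _] := fC (tinv w); have [[CLf _] Lf0] := H3 (tinv w) _ Cf (f0 _).
  rewrite (lt_le_trans _ (H1 _ CLf))// mulr_gt0 ?invr_gt0//.
  by rewrite normr_gt0.
have Lf w : L (tinv w) (f (tinv w)) = p w *: f w.
  by rewrite [f w]fE scalerA divff ?scale1r// gt_eqF// p0.
pose D := 2 * K / rho.
(* Thus [D] also dominates the norm of every [f w], and one constant serves both comparisons of norm
   and product. *)
have KD : K <= D by rewrite /D ler_pdivlMr//; nra.
have D0 : 0 < D := lt_le_trans K0 KD.
have Ln0 w : 0 < opnorm (L w).
  by have [h _] := H4 w; rewrite (lt_le_trans _ h)// invr_gt0.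
have pD w : p w <= theta * D.
  rewrite (le_trans (ler_norm _))// (le_trans (lnorm _))//.
  rewrite (le_trans (opnorm_gt0_le _ (lL _) (Ln0 _)))//.
  have [_ h] := H4 (tinv w).
  by rewrite ler_pM// ?(ltW (Ln0 _))// (le_trans (fK _)).
have Dp w : 1 <= theta * D * p w.
  rewrite -mulrA mulrC -ler_pdivrMr// mul1r.
  have [h _] := H4 (tinv w); rewrite (le_trans h)//; apply: opnorm_le => x x1.
  have [fr _] := fC (tinv w).
  exact: (cone_preserving_le ll K0 H1 rho0 (lL _) (LC _) fr).
pose B := ln (theta * D).
have lnpB w : `|ln (p w)| <= B.
  rewrite -[ln (p w)]subr0 -(@ln1 R).
  apply: ln_dist_le => //; first exact: mulr_gt0.
  by rewrite mulr1.
have mp : measurable_fun setT p.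
  exact: (measurable_bochner ll lnorm (Lmeas f fX)).
have mlnp : measurable_fun setT (fun w => ln (p w)).
  exact: (measurableT_comp (@measurable_ln R) mp).
have ilnp : P.-integrable setT (EFin \o (fun w => ln (p w))).
  exact: bounded_integrable mlnp lnpB.
split => //.
(* The cocycle runs backwards, so the ergodic theorem is needed for [tinv]. *)
have tinvP A : measurable A -> P (tinv @^-1` A) = P A.
  move=> mA; rewrite -tauP; last first.
    by rewrite -[X in measurable X]setTI; exact: mtinv.
  by congr (P _); apply/seteqP; split => x /=; rewrite tauK.
have tinv_erg A : measurable A -> tinv @^-1` A = A -> P A = 0%E \/ P A = 1%E.
  move=> mA tA; apply: tau_erg => //; rewrite -[in LHS]tA.
  by apply/seteqP; split => x /=; rewrite tauK.
have := birkhoff_bounded mtinv tinvP tinv_erg mlnp lnpB.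
apply: filterS => w hw.
rewrite -[RHS]fineK ?integrable_fin_num//.
rewrite -/(Rintegral P setT (fun x => ln (p x))).
apply: (cvg_limn_einf_sup _).2.
apply/cvg_EFin; first exact: nearW.
apply: cvg_of_sublinear_error => e e0; have [k hk] := hw e e0.
(* [k%:R] comes from the Birkhoff sum, [ln D] from replacing the operator norm by [Q]. *)
exists (k%:R + ln D) => n.
pose Q := \prod_(k < n) p (iter k tinv w).
have Q0 : 0 < Q by rewrite prodr_gt0.
have lc := cocycle_linear tinv n w lL.
have cf := cocycle_equivariant n w lL Lf; rewrite -/Q in cf.
have lQ : l (Q *: f w) = Q.
  by have [_ lf] := fC w; rewrite is_linearZ// lf [LHS]mulr1.
have cD x : `|x| <= 1 -> `|cocycle L tinv n w x| <= D * Q.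
  move=> x1; rewrite -[X in D * X]lQ -cf; have [fr _] := fC (iter n tinv w).
  exact: (cone_preserving_le ll K0 H1 rho0 lc (cocycle_stable tinv n w LC) fr).
have ND := opnorm_le cD.
have QN : Q <= D * opnorm (cocycle L tinv n w).
  rewrite -{1}lQ -cf (le_trans (ler_norm _))// (le_trans (lnorm _))//.
  rewrite (le_trans (le_opnorm _ lc cD))// mulrC.
  rewrite ler_pM//; last exact: le_trans (fK _) KD.
  apply: le_trans (normr_ge0 (cocycle L tinv n w 0)) _.
  apply: ub_le_sup; first by exists (D * Q) => _ [x /= x1 <-]; exact: cD.
  by exists 0 => //=; rewrite normr0.
have N0 : 0 < opnorm (cocycle L tinv n w).
  by rewrite -(pmulr_rgt0 _ D0) (lt_le_trans Q0).
have := ln_dist_le N0 Q0 D0 ND QN.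
rewrite /Q (@ln_prod _ (fun k => p (iter k tinv w)))// => h.
have := hk n; rewrite /birkhoff_sum.
move: h; set S := \sum_(_ < _) _; set I := Rintegral _ _ _.
rewrite !ler_norml => /andP[? ?] /andP[? ?]; apply/andP; split; lra.
Qed.
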